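(* Let $G$ be a split graph on $d-1$ nodes. Then the number $\mathrm{s}(\mathrm{H}(G))$ of nonempty faces of the Hansen polytope $\mathrm{H}(G)$ satisfies $$\mathrm{s}(\mathrm{H}(G)) = 3^d + 16\cdot \ell\quad\text{for some } \ell\in\mathbb{N}=\{0,1,2,\dots\},$$ with $\ell=0$ if and only if $G$ is a threshold graph.
   Context: All graphs are finite and simple. A graph $G$ is a split graph if its node set can be partitioned into a clique $C$ and a stable set $S$ (either may be empty). For a graph $G=(V,E)$, the stable set polytope is $\mathrm{stab}(G)=\mathrm{conv}\{\sum_{i\in I}e_i : I\subseteq V \text{ stable}\}\subseteq\mathbb{R}^{V}$ (the empty set is stable). The twisted prism of a polytope $P\subseteq\mathbb{R}^n$ is $\mathrm{tp}(P)=\mathrm{conv}(Q\cup -Q)\subseteq\mathbb{R}^{n+1}$ with $Q=\{1\}\times P$. The Hansen polytope of $G$ is $\mathrm{H}(G)=\mathrm{tp}(\mathrm{stab}(G))$. For a polytope $P$, $\mathrm{s}(P)$ is the number of nonempty faces of $P$, with $P$ itself counted as a face. A node of a graph is dominating if it is adjacent to all other nodes, and isolated if it is adjacent to no other node. A graph is a threshold graph if it can be constructed from the empty graph (no nodes) by repeatedly adding either an isolated node or a dominating node (isolated, resp. dominating, in the graph at the moment of its addition). *)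

(* Defs.v *)
From HB Require Import structures.
From mathcomp Require Import all_boot all_order all_algebra finmap.
From mathcomp Require Import boolp classical_sets functions cardinality reals.

Set Implicit Arguments.
Unset Strict Implicit.
Unset Printing Implicit Defensive.

Import Order.TTheory GRing.Theory Num.Theory.

(** * Finite simple graphs *)

Record sgraph := SGraph {
  node :> finType;
  adj : rel node;
  adj_sym : symmetric adj;
  adj_irr : irreflexive adj }.

Section Graphs.
Variable G : sgraph.
Implicit Types (A C S : {set G}) (v : G).

Definition clique C := [forall u in C, forall v in C, (u != v) ==> adj u v].

Definition stable S := [forall u in S, forall v in S, ~~ adj u v].

Definition split_graph : Prop :=
  exists C S, [/\ C :|: S = [set: G], [disjoint C & S],
                  clique C & stable S].

(* [v] is isolated, resp. dominating, in the subgraph of [G] induced by [A]. *)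
Definition isolated_in A v := [forall u in A, ~~ adj v u].

Definition dominating_in A v := [forall u in A, (u != v) ==> adj v u].

(* [threshold_on A]: the subgraph of [G] induced by [A] is obtained from the
   empty graph by repeatedly adding an isolated or a dominating node.  As adding
   a node leaves the graph on the earlier nodes unchanged, the intermediate
   graphs are induced subgraphs of [G]. *)
Inductive threshold_on : {set G} -> Prop :=
| threshold_empty : threshold_on finset.set0
| threshold_add A v : threshold_on A -> v \notin A ->
    isolated_in (v |: A) v || dominating_in (v |: A) v ->
    threshold_on (v |: A).

Definition threshold_graph : Prop := threshold_on [set: G].

End Graphs.

(** * Polytopes *)

Local Open Scope classical_set_scope.
Local Open Scope ring_scope.

Section Polytopes.
Variable R : realType.

Definition conv (E : lmodType R) (X : set E) : set E :=
  [set x | exists (n : nat) (a : 'I_n -> R) (p : 'I_n -> E),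
     [/\ forall i, 0 <= a i, \sum_(i < n) a i = 1,
         forall i, X (p i) & x = \sum_(i < n) a i *: p i]].

(* The space [R * E], with first coordinate in [R], stands for [R^(n+1)]
   when [E] stands for [R^n]. *)
Definition twisted_prism (E : lmodType R) (P : set E) : set (R^o * E)%type :=
  let Q := [set 1 : R^o] `*` P in
  conv (Q `|` [set - q | q in Q]).

(* A face is the intersection of [P] with the hyperplane of equality of a linear
   inequality [c x <= b] valid on [P]; [c = 0], [b = 0] gives [P] itself. *)
Definition is_face (E : lmodType R) (P F : set E) : Prop :=
  exists (c : {scalar E}) (b : R),
    (forall x, P x -> c x <= b) /\ F = [set x | P x /\ c x = b].

(* [fset_set] is the empty [fset] on an infinite set, so a nonzero value of
   [nb_faces P] is the true number of nonempty faces. *)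
Definition nb_faces (E : lmodType R) (P : set E) : nat :=
  #|` fset_set [set F | is_face P F /\ F !=set0] |.

Variable G : sgraph.

Definition incidence (I : {set G}) : {ffun G -> R^o} :=
  [ffun v => (v \in I)%:R].

Definition stab : set {ffun G -> R^o} :=
  conv [set incidence I | I in [set I : {set G} | stable I]].

Definition hansen_polytope : set (R^o * {ffun G -> R^o})%type := twisted_prism stab.

End Polytopes.

Arguments incidence R {G} I.
Arguments stab R G : clear implicits.
Arguments hansen_polytope R G : clear implicits.

(* Main.v *)
Require Import Defs.
From HB Require Import structures.
From mathcomp Require Import all_boot all_order all_algebra finmap.
From mathcomp Require Import boolp classical_sets functions cardinality reals.
From mathcomp Require Import ring lra.

Set Implicit Arguments.
Unset Strict Implicit.
Unset Printing Implicit Defensive.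

Import Order.TTheory GRing.Theory Num.Theory.

(** Why the theorem holds.  Let [K] be the clique and [S = ~: K] the stable set.
Add to [K] an apex, adjacent to no node of [S].  A stable set of [G] is then a
pair [(k, J)], with [k] in [K] or the apex and [J] a set of nodes of [S] not
adjacent to [k]; the apex stands for the stable sets that avoid [K].  In a
suitable basis, indexed by the nodes and the apex, the vertices of [H(G)] are
the vectors [+-(e_k + \sum_(s in J) e_s)], so that a linear form is nothing but
a weight [a] on the [d] elements of [option G] ([functional_apex]).

Fix a weight.  For a sign [eps] and [k], the best choice of [J] takes all nodes
of the sign [eps] and none of the opposite sign.  Hence the set of maximal
vertices is known once we know which pairs [(eps, k)] reach the maximum [b], and
the signs of [a] at the nodes of [S] that such a [k] leaves free.  The best
values for [k] with the two signs add up to the sum of [`|a s|] over the nodes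
[s] of [S] not adjacent to [k], and this sum is largest at the apex.  If it is
less than [2 * b] at the apex (the unbalanced case), then no [k] reaches [b]
with both signs; if it equals [2 * b] (the balanced case), then [k] reaches [b] with
both signs exactly when all its neighbours in [S] have weight 0.  In each case
one sign vector [f : option G -> {+, 0, -}] records the face: [f k] is the sign
with which [k] reaches [b], or 0 if it does so with neither or with both; [f s]
is the sign of [a s], or 0 if no [k] that reaches [b] leaves [s] free.  The
vectors that occur are described by their support [U] alone:
 - unbalanced: [U] meets the clique side, and every [s] of [S] in [U] has a
   non-neighbour on the clique side of [U];
 - balanced: every [k] on the clique side of [U] has a neighbour in [U] that
   lies in [S].
That distinct codes give distinct faces is [code_face_inj]; that every code
occurs and nothing else does is [tight_realizing_weight] and [tight_coded].

A clique node which shows that [U] is not balanced is adjacent to no node of [S]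
in [U], so that it shows that [U] is unbalanced.  Every sign vector is therefore
a code of at least one kind, and the number of nonempty faces is [3 ^ d] plus
the number of sign vectors of both kinds.  A support of both kinds contains an
alternating 4-cycle: [k, k'] in [K] and [s, s'] in [S] with [k s] and [k' s']
adjacent, [k' s] and [k s'] not.  So it has at least four elements, and carries
[2 ^ #|U|] sign vectors, a multiple of 16.  Conversely an alternating 4-cycle is
itself a support of both kinds, and the split graphs without one are the
threshold graphs ([threshold_graphP]). *)

(** * Sign vectors and their supports *)

Section SignVectors.
Variables (V : finType) (K : {set V}) (e : rel V).
Implicit Types (U : {set V}) (k s : V) (f : {ffun V -> option bool}).

Definition supp f := [set v | f v != None].

(** The supports of the sign vectors that code a face in the unbalanced case: a
node of [U] outside [K] must be left free by some node of [K] that reaches the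
maximum, since otherwise its sign cannot be read off the face. *)
Definition unbalanced U :=
  [exists k in K, k \in U] &&
  [forall s in U :\: K, [exists k in K :&: U, ~~ e k s]].

(** The same in the balanced case, where a node of [K] whose neighbours outside
[K] all have sign 0 reaches the maximum with both signs, and so has no sign of
its own. *)
Definition balanced U :=
  [forall k in K :&: U, [exists s in U :\: K, e k s]].

Lemma unbalancedP U :
  reflect ((exists2 k, k \in K & k \in U) /\
           (forall s, s \in U -> s \notin K ->
              exists k, [/\ k \in K, k \in U & ~~ e k s]))
          (unbalanced U).
Proof.
apply: (iffP andP) => -[kU sU]; split.
- by have [k kK kU'] := exists_inP kU; exists k.
- move=> s s_U sK.
  have /forall_inP/(_ s) := sU; rewrite !inE s_U sK => /(_ isT)/exists_inP[k].
  by rewrite inE => /andP[kK kU'] ek; exists k.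
- by have [k kK kU'] := kU; apply/exists_inP; exists k.
apply/forall_inP => s; rewrite inE => /andP[sK s_U].
have [k [kK kU' ek]] := sU s s_U sK.
by apply/exists_inP; exists k; rewrite ?inE ?kK.
Qed.

Lemma balancedP U :
  reflect (forall k, k \in U -> k \in K ->
              exists s, [/\ s \notin K, s \in U & e k s])
          (balanced U).
Proof.
apply: (iffP forall_inP) => kU k.
  move=> k_U kK; have := kU k; rewrite inE kK k_U => /(_ isT)/exists_inP[s].
  by rewrite inE => /andP[sK s_U] eks; exists s.
rewrite inE => /andP[kK k_U]; have [s [sK s_U eks]] := kU k k_U kK.
by apply/exists_inP; exists s; rewrite // inE sK.
Qed.

(** A node of [K] in [U] without neighbours in [U :\: K] refutes one condition
and is a witness of the other. *)
Lemma unbalanced_or_balanced U : unbalanced U || balanced U.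
Proof.
case: balancedP => [|nII]; first by rewrite orbT.
rewrite orbF; apply/unbalancedP; apply: contra_notP nII => nI k kU kK.
apply: contra_notP nI => nS; split=> [|s sU sK]; first by exists k.
by exists k; split=> //; apply: contra_notN nS => eks; exists s.
Qed.

(** Edges and non-edges alternate along [k s k' s'].  In the bipartite graph
between [K] and [~: K] this is an induced pair of disjoint edges. *)
Definition alt_cycle k k' s s' :=
  [/\ [/\ k \in K, k' \in K, s \notin K & s' \notin K],
      e k s, e k' s', ~~ e k' s & ~~ e k s'].

Lemma alt_cycle_balanced k k' s s' :
  alt_cycle k k' s s' ->
  unbalanced [set k; k'; s; s'] && balanced [set k; k'; s; s'].
Proof.
case=> [[kK k'K sK s'K] eks ek's' ek's eks']; apply/andP; split.
  apply/unbalancedP; split; first by exists k; rewrite // !inE eqxx.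
  move=> x; rewrite !inE -!orbA.
  case/or4P=> /eqP-> xK; [by rewrite kK in xK | by rewrite k'K in xK | |].
    by exists k'; rewrite !inE eqxx orbT.
  by exists k; rewrite !inE eqxx.
apply/balancedP => x; rewrite !inE -!orbA.
case/or4P=> /eqP-> xK.
- by exists s; rewrite !inE eqxx !orbT.
- by exists s'; rewrite !inE eqxx !orbT.
- by rewrite xK in sK.
- by rewrite xK in s'K.
Qed.

(** A node [k] with the fewest neighbours does it: it has a neighbour [s],
which has a non-neighbour [k'], and [k'] has a neighbour that [k] lacks, for it
would otherwise have fewer neighbours than [k]. *)
Lemma balanced_alt_cycle U : unbalanced U -> balanced U ->
  exists k k' s s', [/\ k \in U, k' \in U, s \in U, s' \in U &
                        alt_cycle k k' s s'].
Proof.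
case/unbalancedP=> -[k0 k0K k0U] sU /balancedP kU.
pose N k := [set s in U :\: K | e k s].
have k0P : (k0 \in K) && (k0 \in U) by rewrite k0K.
case: (@arg_minnP V k0 [pred k | (k \in K) && (k \in U)]
          (fun k => #|N k|) k0P) => k /andP[kK k_U] kmin.
have [s [sK s_U eks]] := kU k k_U kK.
have [k' [k'K k'U ek's]] := sU s s_U sK.
have /subsetPn[s'] : ~~ (N k' \subset N k).
  apply/negP => sub.
  have /eqP NE : N k' == N k by rewrite eqEcard sub kmin //= k'K.
  have : s \in N k by rewrite !inE sK s_U.
  by rewrite -NE !inE (negPf ek's) andbF.
rewrite !inE => /andP[/andP[s'K s'U] ek's']; rewrite s'K s'U /= => eks'.
by exists k, k', s, s'.
Qed.

Lemma leq_card_balanced U : unbalanced U -> balanced U -> 3 < #|U|.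
Proof.
move=> cI cII.
have [k [k' [s [s' [kU k'U sU s'U tK]]]]] := balanced_alt_cycle cI cII.
case: tK => -[kK k'K sK s'K] eks ek's' ek's eks'.
have ->: 4 = size [:: k; k'; s; s'] by [].
suff u : uniq [:: k; k'; s; s'].
  rewrite -(card_uniqP u); apply/subset_leq_card/fintype.subsetP => x.
  by rewrite !inE => /or4P[] /eqP->.
have kk' : k != k' by apply: contraNneq ek's => <-.
have ss' : s != s' by apply: contraNneq eks' => <-.
have Ks x y : x \in K -> y \notin K -> x != y.
  by move=> xK; apply: contraNneq => <-.
by rewrite /= !inE !negb_or kk' ss' !Ks.
Qed.

Lemma card_supp_eq U : #|[set f | supp f == U]| = 2 ^ #|U|.
Proof.
have -> : 2 = #|predC1 (None : option bool)|.
  by rewrite cardC1 card_option card_bool.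
rewrite -(card_pffun_on None); apply: eq_card => f; rewrite inE.
apply/eqP/pffun_onP => [<-|[sU nN]].
  split; first by apply/fintype.subsetP => v; rewrite !inE.
  by move=> _ /mapP[v + ->]; rewrite mem_enum !inE.
apply/setP => v; rewrite inE; apply/idP/idP => [fv|vU].
  by apply: (fintype.subsetP sU); rewrite inE.
by have := nN (f v); rewrite !inE; apply; apply: map_f; rewrite mem_enum.
Qed.

(** The two conditions concern the support only, so the sign vectors counted
here come in full classes of [2 ^ #|U|], one for each support [U]. *)
Lemma dvd16_card_both :
  16 %| #|[set f | unbalanced (supp f) && balanced (supp f)]|.
Proof.
rewrite -sum1_card (partition_big supp (fun U => unbalanced U && balanced U));
  last by move=> f; rewrite inE.
apply: dvdn_sum => U cU.
rewrite (eq_bigl (mem [set f | supp f == U])); last first.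
  by move=> f; rewrite !inE andbC; case: eqP => // ->; rewrite cU.
rewrite sum1_card card_supp_eq; case/andP: cU => cI cII.
by rewrite (@dvdn_exp2l 2 4) // leq_card_balanced.
Qed.

Lemma card_unbalanced_balanced :
  #|[set f | unbalanced (supp f)]| + #|[set f | balanced (supp f)]| =
  3 ^ #|V| + #|[set f | unbalanced (supp f) && balanced (supp f)]|.
Proof.
rewrite -cardsUI; congr (_ + _).
  rewrite -[in RHS]card_bool -card_option -card_ffun -cardsT.
  by apply: eq_card => f; rewrite !inE unbalanced_or_balanced.
by apply: eq_card => f; rewrite !inE.
Qed.

End SignVectors.

(** * Threshold graphs and alternating 4-cycles *)

Section Threshold.
Variables (G : sgraph) (K : {set G}).
Hypotheses (cliqueK : clique K) (stableK : stable (~: K)).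
Implicit Types (A : {set G}).

(** Each node of an alternating 4-cycle has a neighbour and a non-neighbour in
it, so the node added last is not among them. *)
Lemma threshold_no_alt_cycle A : threshold_on A ->
  forall k k' s s', k \in A -> k' \in A -> s \in A -> s' \in A ->
    ~ alt_cycle K (@adj G) k k' s s'.
Proof.
elim=> [k k' s s'|{}A v _ IH vA idv k k' s s' kA k'A sA s'A tK];
  first by rewrite inE.
have [[kK k'K sK s'K] eks ek's' ek's eks'] := tK.
have mixed x y y' : x \in v |: A -> y \in v |: A -> y' \in v |: A ->
    adj x y -> ~~ adj x y' -> x != y' -> x \in A.
  move=> xA yA y'A xy xy' ne; move: (xA); rewrite in_setU1 => /predU1P[xv|//].
  case/orP: idv => /forall_inP idv.
    by have := idv y yA; rewrite -xv xy.
  by have := idv y' y'A; rewrite -xv eq_sym ne (negPf xy').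
have Ks x y : x \in K -> y \notin K -> x != y.
  by move=> xK; apply: contraNneq => <-.
apply: (IH k k' s s') tK.
- by apply: (mixed k s s') => //; apply: Ks.
- by apply: (mixed k' s' s) => //; apply: Ks.
- by apply: (mixed s k k') => //; rewrite 1?adj_sym // eq_sym; apply: Ks.
- by apply: (mixed s' k' k) => //; rewrite 1?adj_sym // eq_sym; apply: Ks.
Qed.

(** If no node is isolated or dominating, then each node outside [K] has a
neighbour in [K] and each node in [K] a non-neighbour outside [K]; a node
outside [K] with the fewest neighbours in [K] then starts an alternating
4-cycle. *)
Lemma peel_or_alt_cycle A : A != finset.set0 ->
  (exists2 v, v \in A & isolated_in A v || dominating_in A v) \/
  (exists k k' s s', alt_cycle K (@adj G) k k' s s').
Proof.
case/set0Pn => x xA.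
case: (boolP [exists v in A, isolated_in A v || dominating_in A v]).
  by case/exists_inP => v vA idv; left; exists v.
move/exists_inPn => noid; right.
have nbr s : s \in A -> s \notin K -> exists k, [/\ k \in K, k \in A & adj k s].
  move=> sA sK; have := noid s sA; rewrite negb_or => /andP[+ _].
  rewrite negb_forall_in => /exists_inP[k kA]; rewrite negbK => esk.
  exists k; rewrite adj_sym esk kA; split=> //; apply: contraLR esk => kK.
  by have /forall_inP/(_ s) := stableK; rewrite inE sK => /(_ isT)/forall_inP;
    apply; rewrite inE.
have nonnbr k : k \in A -> k \in K ->
    exists s, [/\ s \notin K, s \in A & ~~ adj k s].
  move=> kA kK; have := noid k kA; rewrite negb_or => /andP[_].
  rewrite negb_forall_in => /exists_inP[s sA].
  rewrite negb_imply => /andP[sk eks].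
  exists s; split=> //; apply: contraNN eks => sK.
  have /forall_inP/(_ k kK)/forall_inP/(_ s sK)/implyP := cliqueK; apply.
  by rewrite eq_sym.
pose N s := [set k in K :&: A | adj k s].
have [s0 s0P] : exists s0, (s0 \notin K) && (s0 \in A).
  have [xK|xK] := boolP (x \in K); last by exists x; rewrite xK.
  by have [s [sK sA _]] := nonnbr x xA xK; exists s; rewrite sK.
case: (@arg_minnP _ s0 [pred s | (s \notin K) && (s \in A)]
         (fun s => #|N s|) s0P) => s /andP[sK sA] smin.
have [k [kK kA eks]] := nbr s sA sK.
have [s' [s'K s'A eks']] := nonnbr k kA kK.
have /subsetPn[k'] : ~~ (N s' \subset N s).
  apply/negP => sub.
  have /eqP NE : N s' == N s by rewrite eqEcard sub smin //= s'K.
  have : k \in N s by rewrite !inE kK kA.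
  by rewrite -NE !inE (negPf eks') andbF.
rewrite !inE => /andP[/andP[k'K k'A] ek's']; rewrite k'K k'A /= => ek's.
by exists k, k', s, s'.
Qed.

Lemma threshold_graphP :
  threshold_graph G <-> ~ exists k k' s s', alt_cycle K (@adj G) k k' s s'.
Proof.
split=> [tG [k [k' [s [s']]]]|no_alt].
  by apply: (threshold_no_alt_cycle tG); rewrite inE.
rewrite /threshold_graph; have [n] := ubnP #|[set: G]|.
elim: n [set: G] => // n IH A; rewrite ltnS => leAn.
have [->|A0] := eqVneq A finset.set0; first exact: threshold_empty.
have [[v vA idv]|//] := peel_or_alt_cycle A0.
rewrite -(finset.setD1K vA); apply: threshold_add; rewrite ?finset.setD1K //.
  by apply: IH; rewrite (leq_trans _ leAn) // [leqRHS](cardsD1 v) vA.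
by rewrite !inE eqxx.
Qed.

End Threshold.

(** * Maximising a weight on signed stable sets *)

Section SplitWeights.
Variables (R : realFieldType) (V : finType) (K : {set V}) (e : rel V) (z : V).
Hypotheses (zK : z \in K) (e_z : forall s, ~~ e z s).
Implicit Types (a : V -> R) (b : R) (eps t : bool) (k s : V) (J : {set V}).
Implicit Types (f : {ffun V -> option bool}).
Local Open Scope ring_scope.

(** A vertex is a sign, an element [k] of [K] and a set [J] outside [K]; the
element [z] plays the apex. *)
Let vertex : Type := (bool * V * {set V})%type.

Definition free k := [set s in ~: K | ~~ e k s].

Definition is_vertex (w : vertex) := (w.1.2 \in K) && (w.2 \subset free w.1.2).

Definition sg eps : R := if eps then 1 else -1.

Definition sgn (x : R) : option bool := if x == 0 then None else Some (0 < x).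

Definition weight a (w : vertex) :=
  sg w.1.1 * (a w.1.2 + \sum_(s in w.2) a s).

(** The largest weight of the vertices with the given sign and clique element,
see [weight_leif] and [top_attained]. *)
Definition top a eps k :=
  sg eps * a k + \sum_(s in free k) Num.max 0 (sg eps * a s).

(** [w] makes the best choice where [f] prescribes one: it contains the free
nodes of its own sign and avoids those of the opposite sign. *)
Definition compat (f : V -> option bool) (w : vertex) :=
  [forall s in free w.1.2,
     (f s != None) ==> ((s \in w.2) == (f s == Some w.1.1))].

Definition tight a b : {set vertex} :=
  [set w | is_vertex w && (weight a w == b)].

(** Whether a vertex of sign [eps] at [k] lies on the face coded by [f], with
[t = true] in the balanced case. *)
Definition meets t f eps k :=
  (f k == Some eps) || t && [forall s in ~: K, e k s ==> (f s == None)].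

Definition code_face t f : {set vertex} :=
  [set w | [&& is_vertex w, meets t f w.1.1 w.1.2 & compat f w]].

Definition coded t f :=
  if t then balanced K e (supp f) else unbalanced K e (supp f).

Lemma sg_max_leif eps (x : R) (inJ : bool) :
  (if inJ then sg eps * x else 0) <= Num.max 0 (sg eps * x)
     ?= iff ((sgn x != None) ==> (inJ == (sgn x == Some eps))).
Proof.
rewrite /sgn /sg; case: (ltgtP x 0) => [x0|x0|->] /=; last first.
- by rewrite mulr0 maxxx if_same; apply/leifP.
- case: eps inJ => -[] /=; apply/leifP;
    rewrite ?mul1r ?mulN1r !(inj_eq Some_inj) /=.
  + by rewrite max_r ?ltW.
  + by rewrite lt_max x0 orbT.
  + by rewrite lt_max oppr_lt0 x0.
  + by rewrite max_l ?oppr_le0 ?ltW.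
case: eps inJ => -[] /=; apply/leifP;
    rewrite ?mul1r ?mulN1r !(inj_eq Some_inj) /=.
- by rewrite lt_max x0.
- by rewrite max_l ?ltW.
- by rewrite max_r ?oppr_ge0 ?ltW.
- by rewrite lt_max oppr_gt0 x0 orbT.
Qed.

Lemma weight_leif a w : is_vertex w ->
  weight a w <= top a w.1.1 w.1.2 ?= iff compat (sgn \o a) w.
Proof.
case: w => [[eps k] J] /andP[/= kK Jk]; rewrite /weight /top /= mulrDr.
rewrite /compat /= mulr_sumr.
have -> : \sum_(s in J) sg eps * a s =
          \sum_(s in free k) (if s \in J then sg eps * a s else 0).
  rewrite -big_mkcondr; apply: eq_bigl => s.
  by rewrite andb_idl // => /(fintype.subsetP Jk).
apply: (@leifD _ _ _ true); first exact/leif_refl.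
by apply: leif_sum => s _; apply: sg_max_leif.
Qed.

Lemma top_attained a eps k : k \in K ->
  exists2 w, is_vertex w & w.1 = (eps, k) /\ weight a w = top a eps k.
Proof.
move=> kK; pose J := [set s in free k | sgn (a s) == Some eps].
have vJ : is_vertex (eps, k, J).
  rewrite /is_vertex /= kK; apply/fintype.subsetP => s.
  by rewrite inE => /andP[].
exists (eps, k, J) => //; split=> //; apply/eqP; rewrite (weight_leif a vJ).
by apply/forall_inP => s sk; rewrite inE sk /= eqxx implybT.
Qed.

Definition absum a k := \sum_(s in free k) `|a s|.

Lemma top_sum a k : top a true k + top a false k = absum a k.
Proof.
rewrite /top /sg mul1r mulN1r addrACA subrr add0r -big_split /=.
apply: eq_bigr => s _; rewrite mul1r mulN1r.
case: (ltgtP (a s) 0) => [x0|x0|->]; last by rewrite oppr0 maxxx normr0 ?addr0.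
  by rewrite max_r ?oppr_ge0 ?ltW // add0r ltr0_norm.
by rewrite max_l ?oppr_le0 ?ltW // addr0 gtr0_norm.
Qed.

(** The apex leaves all nodes outside [K] free; any other [k] misses its
neighbours. *)
Lemma absum_leif a k :
  absum a k <= absum a z ?= iff [forall s in ~: K, e k s ==> (a s == 0)].
Proof.
rewrite /absum [X in X <= _ ?= iff _](_ : _ =
    \sum_(s in ~: K) (if ~~ e k s then `|a s| else 0)); last first.
  by rewrite -big_mkcondr; apply: eq_bigl => s; rewrite inE.
rewrite [X in _ <= X ?= iff _](_ : _ = \sum_(s in ~: K) `|a s|); last first.
  by apply: eq_bigl => s; rewrite inE e_z andbT.
apply: leif_sum => s _; case: (e k s) => /=; last exact/leif_refl.
by apply/leifP; case: (eqVneq (a s) 0) => [->|]; rewrite ?normr0 ?normr_gt0.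
Qed.

Lemma tight_code_face a b t f :
  (forall eps k, k \in K -> top a eps k <= b ?= iff meets t f eps k) ->
  (forall eps k s, k \in K -> meets t f eps k -> s \in free k ->
     f s = sgn (a s)) ->
  tight a b = code_face t f.
Proof.
move=> topb fE; apply/setP => w; rewrite !inE; case vw: (is_vertex w) => //=.
have /andP[kK _] := vw.
have [le1 eq1] := weight_leif a vw; have [le2 eq2] := topb w.1.1 _ kK.
rewrite -eq2; case: (eqVneq (top a w.1.1 w.1.2) b) => [E|nE] /=.
  rewrite -E eq1; apply: eq_forallb_in => s sk /=.
  by rewrite (fE w.1.1 w.1.2) // -eq2 E.
by apply: contraNF nE => /eqP E; rewrite eq_le le2 -E le1.
Qed.

Lemma meets_apex f eps : meets true f eps z.
Proof.
by apply/orP; right; apply/forall_inP => s _; rewrite (negPf (e_z s)).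
Qed.

(** The conditions on a code ensure that each of its nonzero signs outside [K]
influences the face. *)
Lemma coded_visible t f s : coded t f -> s \notin K -> f s != None ->
  exists eps k, [/\ k \in K, meets t f eps k & s \in free k].
Proof.
case: t => [cf sK fs|/unbalancedP[_ cf] sK fs].
  by exists true, z; rewrite meets_apex !inE sK e_z.
have [||k [kK +] ek] := cf s; rewrite ?inE //.
case fk: (f k) => [eps|] // _.
by exists eps, k; rewrite /meets fk eqxx !inE sK ek.
Qed.

Lemma coded_sign t f eps k : coded t f -> k \in K ->
  (f k == Some eps) = meets t f eps k && ~~ meets t f (~~ eps) k.
Proof.
rewrite /meets => + kK; case: t => [/balancedP cf|_] /=; last first.
  by rewrite !orbF; case: (f k) eps => [[]|] [].
case fk: (f k) => [d|] /=; last by rewrite andbN.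
have [||s [sK fs eks]] := cf k; rewrite ?inE ?fk //.
suff -> : [forall s in ~: K, e k s ==> (f s == None)] = false.
  by rewrite !orbF; case: (d) eps => -[].
apply/forall_inP => /(_ s); rewrite inE sK eks => /(_ isT).
by move: fs; rewrite inE => /negPf->.
Qed.

(** Together with [coded_sign], this reads the kind of the code and its signs
on [K] off the pairs that the face meets. *)
Lemma coded_flag t f : t = meets t f true z && meets t f false z.
Proof.
by case: t; rewrite ?meets_apex // /meets /= !orbF; case: (f z) => [[]|].
Qed.

(** The free nodes on which [f] vanishes may be chosen at will, as described by
[d]. *)
Lemma meets_code_face t f eps k (d : V -> bool) :
  k \in K -> meets t f eps k ->
  (forall s, f s != None -> d s = (f s == Some eps)) ->
  (eps, k, [set s in free k | d s]) \in code_face t f.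
Proof.
move=> kK tk dE; rewrite inE /= tk /is_vertex /= kK /=; apply/andP; split.
  by apply/fintype.subsetP => s; rewrite inE => /andP[].
by apply/forall_inP => s sk; rewrite inE sk /=; apply/implyP => /dE->.
Qed.

Lemma code_face_meets t f w : w \in code_face t f -> meets t f w.1.1 w.1.2.
Proof. by rewrite inE => /and3P[]. Qed.

Lemma code_faceS_meets t f t' f' eps k :
  code_face t f \subset code_face t' f' -> k \in K ->
  meets t f eps k -> meets t' f' eps k.
Proof.
move=> /fintype.subsetP sub kK tk.
by have /sub/code_face_meets := meets_code_face kK tk (fun s _ => erefl).
Qed.

(** Membership of the face tests each visible sign: if [f] did not prescribe
[Some d] at [s], a vertex of its face could make there the choice that [f']
forbids. *)
Lemma code_faceS_sign t f t' f' eps k s d :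
  code_face t f \subset code_face t' f' -> k \in K -> s \in free k ->
  meets t f eps k -> f' s = Some d -> f s = Some d.
Proof.
move=> /fintype.subsetP sub kK sk tk f's.
apply/eqP; apply: contraT => fs.
(* membership of [s] in [J] is chosen against [f'], which [f] permits *)
pose D x := if x == s then (if f s is Some d' then d' == eps else d != eps)
            else f x == Some eps.
have : (eps, k, [set x in free k | D x]) \in code_face t f.
  apply: meets_code_face => // x; rewrite /D; have [->|//] := eqVneq x s.
  by case: (f s).
move=> /sub; rewrite inE => /and3P[_ _] /forall_inP/(_ s sk).
rewrite /= f's /= inE sk /D eqxx (inj_eq Some_inj) /=; move: fs.
by case: (f s) => [d'|]; rewrite ?(inj_eq Some_inj);
  case: d eps {D f's tk} => -[]; try case: d'.
Qed.

Lemma code_face_inj t f t' f' : coded t f -> coded t' f' ->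
  code_face t f = code_face t' f' -> (t, f) = (t', f').
Proof.
move=> cf cf' E.
have meetsE eps k : k \in K -> meets t f eps k = meets t' f' eps k.
  by move=> kK; apply/idP/idP; apply: code_faceS_meets; rewrite ?E.
congr (_, _); first by rewrite (coded_flag t f) (coded_flag t' f') !meetsE.
apply/ffunP => v; have [vK|vK] := boolP (v \in K).
  have fE eps : (f v == Some eps) = (f' v == Some eps).
    by rewrite (coded_sign _ cf) // (coded_sign _ cf') // !meetsE.
  by have := (fE true, fE false); case: (f v) (f' v) => [[]|] [[]|] [].
case fv : (f v) => [d|]; last case f'v : (f' v) => [d|] //.
  have [|eps [k [kK tk vk]]] := coded_visible cf vK; first by rewrite fv.
  rewrite meetsE // in tk.
  by apply/esym; apply: (code_faceS_sign (t' := t) _ kK vk tk fv); rewrite E.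
have [|eps [k [kK tk vk]]] := coded_visible cf' vK; first by rewrite f'v.
rewrite -meetsE // in tk.
by rewrite -fv; apply: (code_faceS_sign (t' := t') _ kK vk tk f'v); rewrite E.
Qed.

Definition sgf (o : option bool) : R := if o is Some eps then sg eps else 0.

Lemma sgn_sgf o : sgn (sgf o) = o.
Proof.
case: o => [[]|]; rewrite /sgn /= ?eqxx // ?oner_eq0 ?ltr01 //.
by rewrite oppr_eq0 oner_eq0 oppr_gt0 ltr10.
Qed.

Lemma sgf_eq0 o : (sgf o == 0) = (o == None).
Proof. by case: o => [[]|] /=; rewrite ?eqxx // ?oppr_eq0 oner_eq0. Qed.

Definition gain f eps k := \sum_(s in free k) Num.max 0 (sg eps * sgf (f s)).

(** The maximum of the weight that realises a code.  By [top_sum], half of the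
sum at the apex is the least possible value; adding 1 makes the case
unbalanced. *)
Definition realizing_max t f : R := absum (sgf \o f) z / 2 + (~~ t)%:R.

(** At [k] in [K] with a sign, the value that brings [top] to the maximum for
this sign; at the others, the value that makes [top] the same for both signs. *)
Definition realizing_weight t f v : R :=
  if v \in K then
    if f v is Some eps then sg eps * (realizing_max t f - gain f eps v)
    else (gain f false v - gain f true v) / 2
  else sgf (f v).

Lemma top_realizing_weight t f eps k : k \in K ->
  top (realizing_weight t f) eps k =
  sg eps * realizing_weight t f k + gain f eps k.
Proof.
move=> kK; congr (_ + _); apply: eq_bigr => s.
by rewrite !inE => /andP[sK _]; rewrite /realizing_weight (negPf sK).
Qed.

Lemma gain_sum f k : gain f true k + gain f false k = absum (sgf \o f) k.
Proof. by rewrite -top_sum /top /sg /gain /=; lra. Qed.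

(** The two values of [top] at [k] add up to [absum k].  So [top] is the
maximum for the sign of [k], if it has one, and in the other cases it is
[absum k] minus the maximum or half of [absum k]; either is at most the maximum, with
equality when the case is balanced and [absum k] is as large as at the apex. *)
Lemma top_realizing_weight_leif t f eps k : k \in K ->
  top (realizing_weight t f) eps k <= realizing_max t f ?= iff meets t f eps k.
Proof.
move=> kK; rewrite top_realizing_weight // /realizing_weight kK.
have [leM eqM] := absum_leif (sgf \o f) k.
have nbE : [forall s in ~: K, e k s ==> ((sgf \o f) s == 0)] =
           [forall s in ~: K, e k s ==> (f s == None)].
  by apply: eq_forallb_in => s _ /=; rewrite sgf_eq0.
have gE := gain_sum f k.
have key x : x = absum (sgf \o f) k - realizing_max t f \/
             x = absum (sgf \o f) k / 2 ->
    x <= realizing_max t f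
      ?= iff t && (absum (sgf \o f) k == absum (sgf \o f) z).
  move: leM; rewrite /realizing_max.
  set M := absum _ k; set Mz := absum _ z => leM.
  case: t => /= xE; apply/leifP; last by case: xE; lra.
  case: eqVneq => [E|nE]; first by apply/eqP; case: xE; lra.
  by have : M < Mz; [rewrite lt_def eq_sym nE | case: xE; lra].
rewrite /meets -nbE -eqM; case: (f k) => [d|] /=; last first.
  by apply: key; right; case: eps; rewrite /sg; lra.
rewrite (inj_eq Some_inj); case: eqVneq => [->|nd] /=.
  by apply/leifP/eqP; case: eps; rewrite /sg; lra.
by apply: key; left; case: eps d nd => -[] // _; rewrite /sg; lra.
Qed.

Lemma tight_realizing_weight t f :
  tight (realizing_weight t f) (realizing_max t f) = code_face t f.
Proof.
apply: tight_code_face => [*|eps k s _ _].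
  exact: top_realizing_weight_leif.
by rewrite !inE => /andP[sK _]; rewrite /realizing_weight (negPf sK) sgn_sgf.
Qed.

Lemma weight_realizing_weight t f w : is_vertex w ->
  weight (realizing_weight t f) w <= realizing_max t f.
Proof.
move=> vw; apply: le_trans (weight_leif _ vw) _.
by apply: top_realizing_weight_leif; case/andP: vw.
Qed.

Lemma code_face_neq0 t f : coded t f -> code_face t f != finset.set0.
Proof.
move=> cf; suff [eps [k [kK tk]]] : exists eps k, k \in K /\ meets t f eps k.
  by apply/set0Pn; eexists; apply: (meets_code_face kK tk (fun s _ => erefl)).
case: t cf => [_|/unbalancedP[[k kK]]].
  by exists true, z; rewrite meets_apex.
rewrite inE; case fk: (f k) => [eps|] // _ _; exists eps, k.
by rewrite /meets fk eqxx.
Qed.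

(** The code of a weight: its signs at the visible nodes outside [K], and on
[K] the sign with which an element reaches the maximum, when there is exactly
one. The case is balanced when the apex reaches the maximum with both signs. *)
Lemma tight_coded a b :
  (forall w, is_vertex w -> weight a w <= b) -> tight a b != finset.set0 ->
  exists t f, coded t f /\ tight a b = code_face t f.
Proof.
move=> ab tn0.
have topb eps k : k \in K -> top a eps k <= b.
  by move=> kK; have [w vw [_ <-]] := top_attained a eps kK; apply: ab.
pose T eps k := top a eps k == b.
have [eps0 [k0 [k0K Tk0]]] : exists eps k, k \in K /\ T eps k.
  have /set0Pn[w] := tn0; rewrite inE => /andP[vw /eqP wb].
  have /andP[kK _] := vw; exists w.1.1, w.1.2; split=> //.
  by rewrite /T eq_le topb //= -wb (weight_leif a vw).
pose t := T true z && T false z.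
pose vis s := [exists eps, [exists k in K, T eps k && ~~ e k s]].
pose f := [ffun v => if v \in K then
                       if T true v == T false v then None else Some (T true v)
                     else if vis v then sgn (a v) else None].
have fK eps k : k \in K -> (f k == Some eps) = T eps k && ~~ T (~~ eps) k.
  move=> kK; rewrite ffunE kK.
  by case: eps; case: (T true k); case: (T false k).
have fS eps k s : k \in K -> T eps k -> s \in free k -> f s = sgn (a s).
  move=> kK Tk; rewrite !inE => /andP[sK eks]; rewrite ffunE (negPf sK).
  case: ifPn => // /existsP[]; exists eps; apply/exists_inP; exists k => //.
  by rewrite Tk.
have bothE k : k \in K -> T true k && T false k =
    t && [forall s in ~: K, e k s ==> (f s == None)].
  move=> kK; have [leM eqM] := absum_leif a k.
  have pk := topb true _ kK; have nk := topb false _ kK.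
  have pz := topb true _ zK; have nz := topb false _ zK.
  have sk := top_sum a k; have sz := top_sum a z.
  case tz: t => /=; last first.
    apply: contraFF tz => /andP[/eqP pkb /eqP nkb].
    by apply/andP; split; apply/eqP; lra.
  have /andP[/eqP pzb /eqP nzb] := tz.
  have -> : [forall s in ~: K, e k s ==> (f s == None)] =
            [forall s in ~: K, e k s ==> (a s == 0)].
    apply: eq_forallb_in => s; rewrite inE => sK; congr (_ ==> _).
    rewrite (fS true z) ?inE ?sK ?e_z //; last exact/eqP.
    by rewrite /sgn; case: (a s == 0).
  rewrite -eqM; apply/andP/eqP => [[/eqP pkb /eqP nkb]|E]; first by lra.
  by split; apply/eqP; lra.
have meetsE eps k : k \in K -> meets t f eps k = T eps k.
  move=> kK; rewrite /meets fK // -bothE //.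
  by case: eps; case: (T true k); case: (T false k).
exists t, f; split; last first.
  apply: tight_code_face => [eps k kK|eps k s kK]; rewrite meetsE //.
    by split; first exact: topb.
  exact: fS.
have fN k : k \in K -> (f k != None) = T true k (+) T false k.
  by move=> kK; rewrite ffunE kK; case: (T true k); case: (T false k).
have TN eps k : k \in K -> t = false -> T eps k -> f k != None.
  move=> kK tF Tk; have := bothE k kK; rewrite fN // tF /=.
  by case: eps Tk => ->; case: (T _ k).
rewrite /coded; case tE : t.
  apply/balancedP => k; rewrite inE => fk kK; have := bothE k kK.
  rewrite tE /=; have -> : T true k && T false k = false.
    by move: fk; rewrite fN //; case: (T true k); case: (T false k).
  move/esym/negbT; rewrite negb_forall_in => /exists_inP[s].
  by rewrite inE negb_imply => sK /andP[eks fs]; exists s; rewrite inE.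
apply/unbalancedP; split; first by exists k0; rewrite // inE (TN eps0).
move=> s; rewrite inE => fs sK; move: fs; rewrite ffunE (negPf sK).
case: ifP => // /existsP[eps /exists_inP[k kK /andP[Tk eks]]] _.
by exists k; rewrite inE (TN eps).
Qed.

End SplitWeights.

(** * Counting faces through tight vertex sets *)

Section FacesAndVertices.
Variables (R : realType) (E : lmodType R) (W : finType).
Variables (ok : pred W) (p : W -> E) (P : set E).
Local Open Scope ring_scope.
Local Open Scope classical_set_scope.

Definition valid (c : {scalar E}) (b : R) := forall w, ok w -> c (p w) <= b.

Definition tight_set (c : {scalar E}) (b : R) : {set W} :=
  finset (fun w => ok w && (c (p w) == b)).

(** What the count uses of [P] being the convex hull of the points [p w]. *)
Hypothesis p_in_P : forall w, ok w -> P (p w).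
Hypothesis P_valid : forall c b, valid c b -> forall x, P x -> c x <= b.

(** A large multiple [l * (b - c)] dominates [b' - c'] at the finitely many
vertices, hence on [P], and it vanishes where [c = b].  Used in both directions,
this shows that a face is determined by its vertices. *)
Lemma face_ineq (c c' : {scalar E}) (b b' : R) : valid c b ->
  (forall w, ok w -> c (p w) = b -> b' <= c' (p w)) ->
  forall x, P x -> c x = b -> b' <= c' x.
Proof.
move=> cb cc' x Px cx.
(* term by term, [r w] is the factor that the vertex [w] needs *)
pose r w := `|b' - c' (p w)| / (b - c (p w)).
have r0 w : ok w -> 0 <= r w by move=> /cb le; rewrite divr_ge0 ?subr_ge0.
pose l := \sum_(w | ok w) r w.
pose g (y : E) : R := l * c y - c' y.
have g_lin : linear_for *%R g.
  by move=> u y y'; rewrite /g !linearP /= mulrDr mulrDr mulrCA; ring.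
pose gL : {scalar E} := HB.pack g (GRing.isLinear.Build R E R *%R g g_lin).
suff /P_valid/(_ x Px) : valid gL (l * b - b') by rewrite /= /g cx; lra.
move=> w okw; rewrite /= /g; have := cb w okw; rewrite le_eqVlt.
case/predU1P => [cwb|clt]; first by have := cc' w okw cwb; rewrite cwb; lra.
suff : b' - c' (p w) <= l * (b - c (p w)) by rewrite mulrBr; lra.
have pos : 0 < b - c (p w) by rewrite subr_gt0.
apply: le_trans (ler_norm _) _; rewrite -ler_pdivrMr //.
rewrite /l (bigD1 w) //= lerDl; apply: sumr_ge0 => w' /andP[okw' _].
exact: r0.
Qed.

(** Nonempty faces correspond to the nonempty sets of vertices at which a valid
inequality is tight; it remains to enumerate these without repetition. *)
Lemma nb_faces_codes (T : finType) (X : {set T}) (A : T -> {set W}) :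
  {in X &, injective A} ->
  (forall x, x \in X -> A x != finset.set0 /\
                        exists c b, valid c b /\ tight_set c b = A x) ->
  (forall c b, valid c b -> tight_set c b != finset.set0 ->
     exists2 x, x \in X & tight_set c b = A x) ->
  nb_faces P = #|X|.
Proof.
move=> A_inj A_real A_all.
pose Phi x := [set y | P y /\
  exists c b, [/\ valid c b, tight_set c b = A x & c y = b]].
have PhiE x c b : valid c b -> tight_set c b = A x ->
    Phi x = [set y | P y /\ c y = b].
  move=> cb tE; apply/seteqP; split=> y /= [Py];
    last by split=> //; exists c, b.
  case=> c' [b' [c'b' t'E c'y]]; split=> //; apply/eqP.
  rewrite eq_le P_valid //=; apply: (face_ineq c'b') => // w okw c'w.
  have : w \in tight_set c' b' by rewrite inE okw c'w eqxx.
  by rewrite t'E -tE inE => /andP[_ /eqP->].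
have A_Phi x w : x \in X -> (w \in A x) <-> (ok w /\ Phi x (p w)).
  move=> xX; have [_ [c [b [cb tE]]]] := A_real x xX.
  rewrite (PhiE x c b) // -tE inE; split=> [/andP[okw /eqP cw]|[okw /= [_ ->]]].
    by split=> //; split=> //; exact: p_in_P.
  by rewrite okw eqxx.
have Phi_inj : {in X &, injective Phi}.
  move=> x y xX yX Pxy; apply: A_inj => //; apply/setP => w.
  have [Ax xA] := A_Phi x w xX; have [Ay yA] := A_Phi y w yX.
  apply/idP/idP => [/Ax|/Ay]; first by rewrite Pxy; exact: yA.
  by rewrite -Pxy; exact: xA.
have -> : #|X| = #|` [fset Phi x | x in X]%fset|.
  by rewrite (card_in_imfset _ Phi_inj) cardE.
rewrite -[in RHS](set_fsetK [fset Phi x | x in X]%fset) /nb_faces.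
congr (#|` fset_set _ |); apply/seteqP; split=> F /=.
  case=> -[c [b [cb ->]]] [y [Py cy]].
  have vcb : valid c b by move=> w /p_in_P /cb.
  have [|x xX tE] := A_all c b vcb.
    apply/negP => /eqP t0.
    (* without a tight vertex, the inequality [1 <= 0] would hold at [y] *)
    pose zL : {scalar E} :=
      HB.pack (fun _ : E => 0 : R) (GRing.isLinear.Build R E R *%R (fun _ => 0)
        (fun u _ _ => esym (etrans (addr0 _) (mulr0 u)))).
    have : 1 <= zL y; last by rewrite /= ler10.
    apply: (face_ineq vcb) cy => // w okw cw.
    have : w \in tight_set c b by rewrite inE okw cw eqxx.
    by rewrite t0 inE.
  by apply/imfsetP; exists x => //; rewrite (PhiE x c b).
move=> /imfsetP[x /= xX ->]; have [A0 [c [b [cb tE]]]] := A_real x xX.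
split.
  by exists c, b; rewrite -(PhiE x c b) //; split=> //; exact: P_valid.
by have /set0Pn[w /A_Phi[] // _ Pw] := A0; exists (p w).
Qed.

End FacesAndVertices.

(** * The Hansen polytope of a split graph *)

Lemma sum_delta (R : pzSemiRingType) (I : finType) (P : pred I) (x : I) :
  (\sum_(i | P i) (i == x)%:R = (P x)%:R :> R)%R.
Proof.
case Px: (P x).
  by rewrite (bigD1 x) //= eqxx big1 ?addr0 // => i /andP[_ /negPf->].
by rewrite big1 // => i Pi; case: eqP => // ix; rewrite -ix Pi in Px.
Qed.

Section HansenSplit.
Variables (R : realType) (G : sgraph) (K : {set G}).
Hypotheses (cliqueK : clique K) (stableK : stable (~: K)).
Local Open Scope ring_scope.
Implicit Types (o : option G) (J : {set option G}).

Local Notation E := (R^o * {ffun G -> R^o})%type.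

(** The apex is [None]; it belongs to the clique side and has no neighbours. *)
Definition apexK : {set option G} := finset (oapp (mem K) true).

Definition apex_adj : rel (option G) :=
  fun o o' => if (o, o') is (Some u, Some v) then adj u v else false.

Local Notation is_vtx := (is_vertex apexK apex_adj).

(** A basis of the ambient space in which every vertex of the Hansen polytope
is, up to sign, a sum of basis vectors with exactly one from the clique side:
that one provides the first coordinate 1. *)
Definition apex_vec o : E :=
  ((o \in apexK)%:R, [ffun v => (o == Some v)%:R]).

Definition hansen_vertex (w : bool * option G * {set option G}) : E :=
  sg R w.1.1 *: (apex_vec w.1.2 + \sum_(o in w.2) apex_vec o).

Definition node_set o J : {set G} := [set v | (o == Some v) || (Some v \in J)].

Lemma node_set_stable eps o J : is_vtx (eps, o, J) -> stable (node_set o J).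
Proof.
case/andP=> /= oK /fintype.subsetP Jo.
have J_K v : Some v \in J -> v \in ~: K by move/Jo; rewrite !inE => /andP[].
have o_J u v : o = Some u -> Some v \in J -> ~~ adj u v.
  by move=> ou /Jo; rewrite inE ou => /andP[].
apply/forall_inP => u uI; apply/forall_inP => v; move: uI; rewrite !inE.
case/orP=> [/eqP ou|uJ] /orP[/eqP ov|vJ].
- by have /Some_inj-> : Some u = Some v; [rewrite -ou ov | rewrite adj_irr].
- exact: o_J ou vJ.
- by rewrite adj_sym; apply: o_J ov uJ.
by have /forall_inP/(_ u (J_K u uJ))/forall_inP := stableK; apply; apply: J_K.
Qed.

Lemma node_set_vec eps o J : is_vtx (eps, o, J) ->
  apex_vec o + \sum_(o' in J) apex_vec o' = (1, incidence R (node_set o J)).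
Proof.
case/andP=> /= oK /fintype.subsetP Jo.
have J_K o' : o' \in J -> o' \notin apexK by move/Jo; rewrite !inE => /andP[].
apply/pair_equal_spec; split.
  rewrite /= raddf_sum /= oK big1 ?addr0 // => o' /J_K.
  by move/negPf->.
rewrite /= raddf_sum /=; apply/ffunP => v; rewrite !ffunE sum_ffunE inE.
under eq_bigr do rewrite ffunE.
rewrite (sum_delta _ (fun o' => o' \in J)) /=.
case: eqP => [ov|_]; last by rewrite add0r.
case: (boolP (Some v \in J)) => [/J_K|]; last by rewrite addr0.
by rewrite -ov oK.
Qed.

Lemma stable_node_set (I : {set G}) eps : stable I ->
  exists o J, is_vtx (eps, o, J) /\ node_set o J = I.
Proof.
move=> stI; exists [pick v in I :&: K].
exists [set o | oapp (mem (I :\: K)) false o].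
case: pickP => [k|nok]; rewrite ?inE.
  move=> /andP[kI kK]; split.
    rewrite /is_vertex /= inE /= kK; apply/fintype.subsetP => -[v|];
      rewrite !inE //=.
    rewrite inE => /andP[vK vI]; rewrite vK /=.
    by have /forall_inP/(_ k kI)/forall_inP := stI; apply.
  apply/setP => v; rewrite !inE /= (inj_eq Some_inj).
  apply/orP/idP => [[/eqP<-//|]|vI]; first by rewrite inE => /andP[].
  have [vK|vK] := boolP (v \in K); [left|by right; rewrite inE vK].
  apply: contraT => kv.
  have /forall_inP/(_ k kK)/forall_inP/(_ v vK)/implyP/(_ kv) := cliqueK.
  by have /forall_inP/(_ k kI)/forall_inP/(_ v vI)/negPf-> := stI.
split.
  by rewrite /is_vertex /= inE /=; apply/fintype.subsetP => -[v|];
     rewrite !inE //= inE => /andP[->].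
apply/setP => v; rewrite !inE /=.
by have := nok v; rewrite !inE; case: (v \in I); case: (v \in K).
Qed.

Lemma sub_conv (F : lmodType R) (X : set F) x : X x -> conv X x.
Proof.
move=> Xx; exists 1%N, (fun=> 1), (fun=> x).
by rewrite !big_ord1 scale1r; split=> // _; apply: ler01.
Qed.

Lemma hansen_vertex_in w : is_vtx w -> hansen_polytope R G (hansen_vertex w).
Proof.
case: w => [[eps o] J] vw; rewrite /hansen_vertex /= (node_set_vec vw).
apply: sub_conv.
have Q : (([set 1] : set R^o) `*` stab R G)%classic
           (1, incidence R (node_set o J)).
  split=> //=; apply: sub_conv; exists (node_set o J) => //.
  exact: node_set_stable vw.
case: eps {vw} => /=; rewrite ?scale1r ?scaleN1r; [by left|right].
by exists (1, incidence R (node_set o J)).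
Qed.

(** With [h] the identity this is the bound on a convex hull; with [h] affine
it also bounds [c] on the bases [+-(1, P)] of a twisted prism. *)
Lemma conv_le (F F' : lmodType R) (c : {scalar F'}) (h : F -> F') b
    (X : set F) :
  (forall (n : nat) (a : 'I_n -> R) (x : 'I_n -> F), \sum_i a i = 1 ->
     h (\sum_i a i *: x i) = \sum_i a i *: h (x i)) ->
  (forall x, X x -> c (h x) <= b) -> forall x, conv X x -> c (h x) <= b.
Proof.
move=> hE cb _ [n [a [x [a0 a1 Xx ->]]]]; rewrite hE // linear_sum.
rewrite -[leRHS]mul1r -a1 mulr_suml; apply: ler_sum => i _.
by rewrite linearZ ler_wpM2l // cb.
Qed.

Lemma hansen_valid (c : {scalar E}) b :
  (forall w, is_vtx w -> c (hansen_vertex w) <= b) ->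
  forall x, hansen_polytope R G x -> c x <= b.
Proof.
move=> cb; apply: (conv_le (h := idfun)) => //.
have Qb eps x : stab R G x -> c (sg R eps *: ((1, x) : E)) <= b.
  apply: (conv_le (h := fun x : {ffun G -> R^o} => sg R eps *: ((1, x) : E))).
    move=> n a y a1; under [RHS]eq_bigr do rewrite scalerA mulrC -scalerA.
    rewrite -scaler_sumr; congr (_ *: _); rewrite [RHS]surjective_pairing.
    apply/pair_equal_spec; split.
      rewrite raddf_sum /= -[LHS]a1; apply: eq_bigr => i _.
      by rewrite /= [RHS]mulr1.
    by rewrite raddf_sum.
  move=> _ [I stI <-]; have [o [J [vw <-]]] := stable_node_set eps stI.
  by rewrite -(node_set_vec vw); apply: cb vw.
move=> [r y] [[/= -> sy]|[[r' x] [/= -> sx] <-]].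
  by have := Qb true y sy; rewrite scale1r.
by have := Qb false x sx; rewrite scaleN1r.
Qed.

Lemma vertex_weight (c : {scalar E}) w :
  c (hansen_vertex w) = weight (c \o apex_vec) w.
Proof. by rewrite /weight linearZ linearD linear_sum. Qed.

(** The linear form with the given values on the basis [apex_vec]: the
coordinate of [x] at the apex is [x.1] minus the coordinates on [K]. *)
Definition functional (a : option G -> R) (x : E) : R :=
  a None * (x.1 - \sum_(v in K) x.2 v) + \sum_v a (Some v) * x.2 v.

Lemma functional_linear a : linear_for *%R (functional a).
Proof.
move=> u [x1 x2] [y1 y2]; rewrite /functional /=.
under eq_bigr do rewrite !ffunE.
under [X in _ + X = _]eq_bigr do rewrite !ffunE mulrDr mulrCA.
rewrite !big_split /= -!mulr_sumr; rewrite /GRing.scale /=; ring.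
Qed.

HB.instance Definition _ a :=
  GRing.isLinear.Build R E R *%R (functional a) (functional_linear a).

Lemma functional_apex a : functional a \o apex_vec =1 a.
Proof.
case=> [u|] /=; rewrite /functional /apex_vec /= inE /=.
  have -> : \sum_(v in K) [ffun v => (Some u == Some v)%:R : R^o] v =
            (u \in K)%:R :> R.
    rewrite -(sum_delta _ (fun v => v \in K)); apply: eq_bigr => v _.
    by rewrite ffunE (inj_eq Some_inj) eq_sym.
  rewrite subrr mulr0 add0r (bigD1 u) //= ffunE eqxx mulr1 big1 ?addr0 // => v.
  by rewrite ffunE (inj_eq Some_inj) eq_sym => /negPf->; rewrite mulr0.
by rewrite !big1 ?subr0 ?addr0 ?mulr1 // => v _; rewrite ffunE ?mulr0.
Qed.

Lemma nb_faces_hansen : nb_faces (hansen_polytope R G) =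
  (#|[set f : {ffun option G -> option bool} |
        unbalanced apexK apex_adj (supp f)]| +
   #|[set f : {ffun option G -> option bool} |
        balanced apexK apex_adj (supp f)]|)%N.
Proof.
pose T : finType := (bool * {ffun option G -> option bool})%type.
pose X : {set T} := [set x : T | coded apexK apex_adj x.1 x.2].
have noneK : None \in apexK by rewrite inE.
have none_adj o : ~~ apex_adj None o by [].
have tightE (c : {scalar E}) b :
    tight_set is_vtx hansen_vertex c b = tight apexK apex_adj (c \o apex_vec) b.
  by apply/setP => w; rewrite !inE vertex_weight.
rewrite (nb_faces_codes hansen_vertex_in hansen_valid (X := X)
           (A := fun x => code_face apexK apex_adj x.1 x.2)).
- rewrite -sum1_card (eq_bigl (fun x => coded apexK apex_adj x.1 x.2)) => [|x];
    last by rewrite inE.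
  rewrite -(pair_big_dep xpredT (fun t f => coded apexK apex_adj t f)
              (fun _ _ => 1%N)) /= big_bool addnC /=.
  by congr (_ + _)%N; rewrite sum1_card; apply: eq_card => f; rewrite !inE.
- move=> [t f] [t' f']; rewrite !inE /= => cf cf'.
  exact: code_face_inj noneK none_adj _ _ _ _ cf cf'.
- move=> [t f]; rewrite inE /= => cf; split.
    exact: (code_face_neq0 noneK none_adj cf).
  pose a := realizing_weight R apexK apex_adj None t f.
  pose h := realizing_max R apexK apex_adj None t f.
  have aE : functional a \o apex_vec =1 a := functional_apex a.
  have wE w : functional a (hansen_vertex w) = weight a w.
    rewrite vertex_weight /weight; congr (_ * (_ + _)); first exact: aE.
    by apply: eq_bigr => o _; apply: aE.
  exists (functional a), h; split=> [w vw|].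
    by rewrite /= wE; apply: weight_realizing_weight.
  rewrite -(tight_realizing_weight R apexK none_adj); apply/setP => w.
  by rewrite !inE /= wE.
move=> c b cb; rewrite tightE => tn0.
have [|t [f [cf ->]]] := tight_coded noneK none_adj _ tn0.
  by move=> w vw; rewrite -vertex_weight; apply: cb.
by exists (t, f); rewrite ?inE.
Qed.

Lemma apex_bothP :
  [set f : {ffun option G -> option bool} |
     unbalanced apexK apex_adj (supp f) && balanced apexK apex_adj (supp f)]
    = finset.set0 <->
  ~ exists k k' s s', alt_cycle K (@adj G) k k' s s'.
Proof.
split=> [c0 [k [k' [s [s' tK]]]]|no_alt].
  have /alt_cycle_balanced cU :
      alt_cycle apexK apex_adj (Some k) (Some k') (Some s) (Some s').
    by case: tK => -[*]; split; first split; rewrite ?inE.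
  set U := [set _; _; _; _] in cU.
  pose f : {ffun option G -> option bool} :=
    [ffun v => if v \in U then Some true else None].
  have fU : supp f = U by apply/setP => v; rewrite inE ffunE; case: ifP.
  by have := finset.in_set0 f; rewrite -c0 inE fU cU.
apply/setP => f; rewrite [RHS]inE inE; apply/andP => -[cI cII]; apply: no_alt.
have [k [k' [s [s' [_ _ _ _ tK]]]]] := balanced_alt_cycle cI cII.
case: k k' s s' tK => [k|] [k'|] [s|] [s'|] [[kK k'K sK s'K] //= ? ? ? ?].
by exists k, k', s, s'; split; first split; rewrite ?inE in kK k'K sK s'K *.
Qed.

End HansenSplit.

Theorem corollary4p8 (R : realType) (d : nat) (G : sgraph)
    (d_gt0 : (0 < d)%N) (card_G : #|G| = (d - 1)%N) (split_G : split_graph G) :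
  exists l : nat, nb_faces (hansen_polytope R G) = (3 ^ d + 16 * l)%N /\
                  (l = 0%N <-> threshold_graph G).
Proof.
have [K [S [KS dKS cK sS]]] := split_G.
have SE : S = ~: K.
  apply/setP => v; have : v \in K :|: S by rewrite KS inE.
  rewrite !inE; case: (boolP (v \in K)) => //= vK _.
  exact: (disjointFr dKS vK).
rewrite {}SE {dKS KS} in sS.
set X := [set f | unbalanced (apexK K) (@apex_adj G) (supp f) &&
                  balanced (apexK K) (@apex_adj G) (supp f)].
have /dvdnP[l XE] : 16 %| #|X| := dvd16_card_both _ _.
have card_oG : #|{: option G}| = d by rewrite card_option card_G subn1 prednK.
exists l; split.
  by rewrite (nb_faces_hansen R cK sS) card_unbalanced_balanced card_oG XE
             mulnC.
rewrite (threshold_graphP cK sS) -apex_bothP -/X.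
split=> [l0|/eqP]; first by apply/eqP; rewrite -cards_eq0 XE l0.
by rewrite -cards_eq0 XE muln_eq0 orbF => /eqP.
Qed.
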